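(* Let $k$ and $n\ge 3$ be integers. The $k$-coprime graph $\mathrm{CP}(k,n)$ is Hamiltonian if and only if either (i) both $n$ and $k$ are odd, or (ii) $n$ is even, and there is an odd prime $p<n$ with $p\nmid k$, and there is an odd prime $q<n$ with $q\nmid k+n-1$.
   Context: For an integer $k$ and a positive integer $n$, the $k$-coprime graph of order $n$, denoted $\mathrm{CP}(k,n)$, is the simple graph with vertex set $\{k,k+1,\ldots,k+n-1\}$ in which two distinct vertices $a,b$ are adjacent if and only if $\gcd(a,b)=1$. Here $\gcd(a,0)=|a|$ for every integer $a$, so a vertex $0$ can only be adjacent to $\pm1$. A graph is Hamiltonian if it contains a cycle passing through every vertex exactly once. *)

(* Defs.v *)
From HB Require Import structures.
From mathcomp Require Import all_boot all_order all_algebra.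
Set Implicit Arguments. Unset Strict Implicit. Unset Printing Implicit Defensive.
Import Order.TTheory GRing.Theory Num.Theory.
Local Open Scope ring_scope.

Definition cp_vertex (k : int) (n : nat) := {x : int | (k <= x) && (x < k + n%:Z)}.

(* The distinctness clause matters at 1 and -1, which are coprime to
   themselves. Note that gcdz a 0 = `|a|, so 0 is adjacent only to 1 and -1. *)
Definition CP (k : int) (n : nat) : rel (cp_vertex k n) :=
  fun a b => (a != b) && (gcdz (val a) (val b) == 1).

Lemma CP_sym (k : int) (n : nat) : symmetric (@CP k n).
Proof. by move=> a b; rewrite /CP eq_sym gcdzC. Qed.

Lemma CP_irrefl (k : int) (n : nat) : irreflexive (@CP k n).
Proof. by move=> a; rewrite /CP eqxx. Qed.

(* For a symmetric irreflexive e. The sequence c lists the vertices in cyclic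
   order; the size condition rules out the degenerate e-cycles of length
   at most 2 (which include [::] and [:: x; y]), not cycles in a graph. *)
Definition hamiltonian (V : eqType) (e : rel V) : Prop :=
  exists c : seq V, [/\ (3 <= size c)%N, cycle e c, uniq c & forall x : V, x \in c].

(* Main.v *)
Require Import Defs.
From mathcomp Require Import all_boot all_order all_algebra.
From mathcomp Require Import zify.
Import GRing.Theory.
Local Open Scope ring_scope.

(** Even vertices are pairwise non-adjacent, so a Hamiltonian cycle forces k odd
    when n is odd and alternates parities when n is even.  In the latter case an
    end vertex divisible by every odd prime below n has a single neighbour of the
    other parity, the vertex next to it.

    Conversely, let n be even and write b = k+n-1.  By induction on n we build a
    cycle through the edges {k, k+1} and {b-1, b}.  Let p and q be the least odd
    primes not dividing k and b respectively, with q <= p after the reflection x |-> -x.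
    - If k+p = b, close up the path k, ..., b.  If n-1 <= p+q, an explicit cycle
      with the chords {k, k+p}, {b, b-q} works, because every odd prime below p
      divides k and so vertices close to k behave like those close to 0.
    - Otherwise, take a cycle for k, ..., b-q+1 and insert b, b-1, ..., b-q+2 into
      its edge {b-q, b-q+1}.  The induction hypothesis applies unless all odd
      primes up to n-q divide b-q+1, which forces q = 3 (a prime factor of q-2
      divides b); then b is adjacent to k+2 and an explicit cycle exists if p > 3,
      while if p = 3 the mirror image of the reduction applies.
    For n and k odd, delete an end vertex, take the cycle on the n-1 remaining
    vertices, and put the end vertex back into the marked edge next to it; one of
    the two ends always satisfies the hypothesis of the even case when n >= 5. *)

(** * Coprimality of two integers, tested on the primes dividing their difference *)

Definition cop : rel int := fun x y => (x != y) && (gcdz x y == 1).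

Lemma cop_sym : symmetric cop.
Proof. by move=> x y; rewrite /cop eq_sym gcdzC. Qed.

Lemma cop_opp (x y : int) : cop (- x) (- y) = cop x y.
Proof. by rewrite /cop /gcdz !abszN; congr (~~ _ && _); lia. Qed.

Lemma dvdz_subr (r : nat) (x y : int) :
  (r %| x)%Z -> (r %| y)%Z -> (r %| y - x)%Z.
Proof. by move=> rx ry; rewrite rpredB. Qed.

Lemma cop_prime (x y : int) : x != y ->
  (forall r : nat, prime r -> (r %| x)%Z -> ~~ (r %| y)%Z) -> cop x y.
Proof.
move=> nxy h; rewrite /cop nxy /= /gcdz.
case: (ltngtP (gcdn `|x| `|y|) 1) => [g0|g1|->] //.
- by move: g0; rewrite ltnS leqn0 eqn0Ngt gcdn_gt0; lia.
- have pr := pdiv_prime g1.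
  have dv := pdiv_dvd (gcdn `|x| `|y|).
  move: (h _ pr); rewrite !dvdzE !absz_nat.
  by rewrite (dvdn_trans dv (dvdn_gcdl _ _)) (dvdn_trans dv (dvdn_gcdr _ _)) => /(_ isT).
Qed.

Lemma cop_addr (x : int) (d : nat) : (0 < d)%N ->
  (forall r : nat, prime r -> (r %| d)%N -> ~~ (r %| x)%Z) -> cop x (x + d%:Z).
Proof.
move=> d0 h; apply: cop_prime; first lia.
move=> r pr rx; apply/negP => ry; move: (dvdz_subr _ _ _ rx ry).
rewrite (_ : x + d%:Z - x = d%:Z); last lia.
by rewrite dvdzE !absz_nat => /(h _ pr); rewrite rx.
Qed.

Lemma cop_addr_odd (x : int) (d : nat) : odd d ->
  (forall r : nat, prime r -> odd r -> (r %| d)%N -> ~~ (r %| x)%Z) -> cop x (x + d%:Z).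
Proof.
move=> od h; apply: cop_addr; first by case: d od {h}.
by move=> r pr rd; apply: h => //; apply: dvdn_odd od.
Qed.

Lemma cop_addr_prime (x : int) (p : nat) : prime p -> ~~ (p %| x)%Z -> cop x (x + p%:Z).
Proof.
move=> pp npx; apply: cop_addr => [|r pr]; first exact: prime_gt0.
by rewrite dvdn_prime2 // => /eqP->.
Qed.

Lemma cop_subr_prime (x : int) (p : nat) : prime p -> ~~ (p %| x)%Z -> cop x (x - p%:Z).
Proof.
move=> pp npx; rewrite -cop_opp opprD opprK; apply: cop_addr_prime => //.
by rewrite rpredN.
Qed.

Lemma cop_succ (x : int) : cop x (x + 1).
Proof. by apply: (cop_addr_odd x 1) => // r pr _; rewrite dvdn1 => /eqP r1; rewrite r1 in pr. Qed.

Lemma cop_pred (x : int) : cop x (x - 1).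
Proof. by rewrite cop_sym -{2}(subrK 1 x) cop_succ. Qed.

(** * Runs of consecutive integers as path segments *)

Definition run (a : int) (l : nat) := [seq a + i%:Z | i <- iota 0 l].
Arguments run : simpl never.

Lemma size_run (a : int) (l : nat) : size (run a l) = l.
Proof. by rewrite size_map size_iota. Qed.

Lemma mem_run (a : int) (l : nat) (x : int) : (x \in run a l) = (a <= x < a + l%:Z).
Proof.
apply/mapP/idP => [[i]|h]; first by rewrite mem_iota => h ->; lia.
by exists `|x - a|%N; rewrite ?mem_iota; lia.
Qed.

Lemma run_uniq (a : int) (l : nat) : uniq (run a l).
Proof. by rewrite map_inj_uniq ?iota_uniq // => i j; lia. Qed.

Lemma runS (a : int) (l : nat) : run a l.+1 = a :: run (a + 1) l.
Proof.
rewrite /run /= addr0 (iotaDl 1 0) -map_comp; congr (_ :: _).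
by apply: eq_map => i /=; lia.
Qed.

Lemma runSr (a : int) (l : nat) : run a l.+1 = rcons (run a l) (a + l%:Z).
Proof. by rewrite /run -addn1 iotaD map_cat cats1. Qed.

(** Consecutive integers are coprime, so a run inside a path imposes no condition except where it is
    left. *)
Lemma path_run (x : int) (l : nat) s : path cop x (run (x + 1) l ++ s) = path cop (x + l%:Z) s.
Proof.
elim: l x => [|l IH] x; first by rewrite addr0.
by rewrite runS /= cop_succ IH /=; congr path; lia.
Qed.

Lemma last_run (x : int) (l : nat) : last x (run (x + 1) l) = x + l%:Z.
Proof.
elim: l x => [|l IH] x; first by rewrite /= addr0.
by rewrite runS /= IH; lia.
Qed.

Lemma path_run_rev (a : int) (l : nat) s :
  path cop (a + l%:Z) (rev (run a l) ++ s) = path cop a s.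
Proof.
elim: l a s => [|l IH] a s; first by rewrite addr0.
rewrite runS rev_cons cat_rcons (_ : a + _ = a + 1 + l%:Z) ?IH /=; last lia.
by rewrite cop_sym cop_succ.
Qed.

(** * Hamiltonian cycles as plain integer sequences *)

Definition ham_cycle (k : int) (n : nat) (c : seq int) :=
  cycle cop c && perm_eq c (run k n).

(** A list of size n that contains n distinct integers has no room for repetitions. Explicit cycles
    are thus checked by size and coverage alone. *)
Lemma perm_run (k : int) (n : nat) (c : seq int) :
  size c = n -> (forall x, k <= x < k + n%:Z -> x \in c) -> perm_eq c (run k n).
Proof.
move=> sc sub; rewrite perm_sym.
have sub' : {subset run k n <= c} by move=> x; rewrite mem_run => /sub.
have sz : (size c <= size (run k n))%N by rewrite size_run sc.
have [_ eqi] := uniq_min_size (run_uniq k n) sub' sz.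
by apply: uniq_perm (run_uniq k n) (leq_size_uniq (run_uniq k n) sub' sz) _ => x; exact: eqi.
Qed.

Lemma ham_cycleI (k : int) (n : nat) (c : seq int) :
  cycle cop c -> size c = n -> (forall x, k <= x < k + n%:Z -> x \in c) ->
  ham_cycle k n c.
Proof. by move=> cc sc sub; rewrite /ham_cycle cc perm_run. Qed.

Lemma ham_cycle_catC (k : int) n s t : ham_cycle k n (s ++ t) = ham_cycle k n (t ++ s).
Proof. by rewrite /ham_cycle -rot_size_cat rot_cycle perm_rot. Qed.

Lemma ham_cycle_rev (k : int) (n : nat) c : ham_cycle k n (rev c) = ham_cycle k n c.
Proof.
rewrite /ham_cycle rev_cycle perm_rev; congr (_ && _).
by apply: eq_cycle => x y /=; rewrite cop_sym.
Qed.

Lemma ham_cycle_opp (k : int) (n : nat) c :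
  ham_cycle k n c -> ham_cycle (1 - k - n%:Z) n (map -%R c).
Proof.
case/andP=> cc pc; apply: ham_cycleI.
- by rewrite cycle_map (eq_cycle (e' := cop)) // => x y; exact: cop_opp.
- by rewrite size_map (perm_size pc) size_run.
- move=> x hx; rewrite -[x]opprK map_f // (perm_mem pc) mem_run; lia.
Qed.

Lemma ham_cycle_hamiltonian (k : int) (n : nat) c : (3 <= n)%N -> ham_cycle k n c -> hamiltonian (@CP k n).
Proof.
move=> n3 /andP[cc pc].
have [c' ec] : exists c' : seq (cp_vertex k n), map val c' = c.
  have : all (fun x => (k <= x) && (x < k + n%:Z)) c.
    by apply/allP => x; rewrite (perm_mem pc) mem_run.
  elim: c {cc pc} => [|x c IH] /=; first by exists [::].
  by case/andP=> hx /IH[c' <-]; exists (Sub x hx :: c'); rewrite /= ?SubK.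
exists c'; split.
- by rewrite -(size_map val) ec (perm_size pc) size_run.
- by move: cc; rewrite -ec cycle_map; apply: sub_cycle => x y /=; rewrite /CP /cop.
- by rewrite -(map_inj_uniq val_inj) ec (perm_uniq pc) run_uniq.
- by move=> x; rewrite -(mem_map val_inj) ec (perm_mem pc) mem_run; case: x.
Qed.

Lemma hamiltonian_ham_cycle (k : int) (n : nat) :
  hamiltonian (@CP k n) -> exists c, ham_cycle k n c.
Proof.
case=> c [c3 cc uc mc]; exists (map val c).
rewrite /ham_cycle cycle_map; apply/andP; split.
  by apply: sub_cycle cc => x y /=; rewrite /CP /cop.
apply: uniq_perm; rewrite ?run_uniq ?(map_inj_uniq val_inj) // => x.
rewrite mem_run; apply/mapP/idP => [[y _ ->]|hx]; first by case: y.
by exists (Sub x hx); rewrite ?mc ?SubK.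
Qed.

(** * Cycles through the edges at both ends *)

(* The two marked edges {k, k+1} and {b-1, b}, b = k+n-1, are where further
   vertices get inserted; the cycle is cut open at the second one. *)
Definition marked_cycle (k : int) (n : nat) : Prop :=
  exists s x y t, [/\ ham_cycle k n (k + n%:Z - 1 :: s ++ x :: y :: t),
    last y t = k + n%:Z - 2 &
    (x = k /\ y = k + 1) \/ (x = k + 1 /\ y = k)].

Lemma marked_cycle_ham (k : int) (n : nat) : marked_cycle k n -> exists c, ham_cycle k n c.
Proof. by case=> s [x [y [t [h _ _]]]]; eexists; exact: h. Qed.

Lemma marked_cycle_opp (k : int) (n : nat) : (4 <= n)%N ->
  marked_cycle k n -> marked_cycle (1 - k - n%:Z) n.
Proof.
move=> n4 [s [x [y [t [hc ht hxy]]]]].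
(* With [t] empty, [y] would be k+n-2, but it is k or k+1 and n >= 4. *)
case/lastP: t hc ht => [|t z] hc /=; first lia.
rewrite last_rcons => hz; subst z; set b := k + n%:Z - 1 in hc.
(* The negated cycle must start at -k and end at -(k+1). The order of k and k+1 decides whether it
   is traversed backwards. *)
case: hxy => -[ex ey]; subst x y.
- exists (map -%R (rev s)), (- b), (- (k + n%:Z - 2)), (map -%R (rev t ++ [:: k + 1])).
  split; last by left; lia.
    have := hc; rewrite -cat_cons -cat_rcons ham_cycle_catC -ham_cycle_rev.
    move/ham_cycle_opp; congr ham_cycle.
    rewrite rev_cat rev_rcons rev_cons rev_cons rev_rcons -!cats1 /= -!catA /= map_cat /=.
    by congr (_ :: _); lia.
  by rewrite map_cat last_cat /=; lia.
- exists (map -%R t), (- (k + n%:Z - 2)), (- b), (map -%R (s ++ [:: k + 1])).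
  split; last by right; lia.
    have := hc; rewrite -cat_cons -cat_rcons ham_cycle_catC.
    move/ham_cycle_opp; congr ham_cycle.
    rewrite -!cats1 /= -!catA /= map_cat /=.
    by congr (_ :: _); lia.
  by rewrite map_cat last_cat /=; lia.
Qed.

(* Splits the edge {b-q, b-q+1} by the chord {b-q, b} and the descent b, ..., b-q+1. *)
Lemma marked_cycle_extend (k : int) (n q : nat) : (2 < q)%N -> (q < n)%N ->
  cop (k + n%:Z - 1) (k + n%:Z - 1 - q%:Z) ->
  marked_cycle k (n - q).+1 -> marked_cycle k n.
Proof.
move=> q2 qn; set b := k + n%:Z - 1 => hcop [s [x [y [t [hc ht hxy]]]]].
have eb : k + (n - q).+1%:Z - 1 = b - q%:Z + 1 by lia.
rewrite eb in hc.
have {}ht : last y t = b - q%:Z by rewrite ht /b; lia.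
move eu: (s ++ _) hc => u /andP[cc pc].
have hc' : ham_cycle k n (b :: rev (run (b - q%:Z + 1) q.-1) ++ u).
  apply: ham_cycleI.
  - rewrite /= -cats1 -catA.
    rewrite {1}(_ : b = b - q%:Z + 1 + (q.-1)%:Z) ?path_run_rev; last lia.
    move: cc; rewrite /= -cats1 !cat_path => /andP[-> _] /=.
    by rewrite -eu last_cat /= ht cop_sym hcop.
  - move: (perm_size pc); rewrite size_run /= size_cat size_rev size_run; lia.
  - move=> z hz; move: (perm_mem pc z).
    rewrite mem_run !inE mem_cat mem_rev mem_run; case: (z \in u); lia.
exists (rev t), y, x, (rev s ++ run (b - q%:Z + 1) q.-1).
split; last by case: hxy; [right|left]; lia.
  move: hc'; rewrite -ham_cycle_rev rev_cons rev_cat revK -cats1 ham_cycle_catC.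
  by rewrite -eu rev_cat !rev_cons -!cats1 -!catA.
rewrite (_ : q.-1 = q.-2.+1); last lia.
rewrite runS last_cat /= last_run; lia.
Qed.

Ltac lia_nodvd :=
  repeat match goal with
  | H : context [dvdz] |- _ => clear H
  | H : context [dvdn] |- _ => clear H
  | H : context [prime] |- _ => clear H
  end; lia.

Lemma marked_cycle_closed (k : int) (n : nat) : (3 < n)%N ->
  cop k (k + n%:Z - 1) -> marked_cycle k n.
Proof.
move=> n4 hcop; exists [::], k, (k + 1), (run (k + 1 + 1) (n - 3)).
split; last by left.
  apply: ham_cycleI.
  - rewrite /= cop_sym hcop cop_succ -cats1 path_run /= andbT.
    rewrite (_ : k + n%:Z - 1 = k + 1 + (n - 3)%:Z + 1); last lia.
    exact: cop_succ.
  - by rewrite /= size_run; lia.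
  - by move=> z hz; rewrite !inE mem_run; lia.
by rewrite last_run; lia.
Qed.

(* In coordinates relative to k, with m = n-1, the cycle is
   m, e, e-1, ..., 2, e+1, ..., p-1, 1, 0, p, p+1, ..., m-1. *)
Lemma marked_cycle_chords (k : int) (n p e : nat) :
  (1 < e)%N -> (e < p)%N -> (p.+1 < n)%N ->
  cop k (k + p%:Z) -> cop (k + n%:Z - 1) (k + e%:Z) ->
  cop (k + 1) (k + p%:Z - 1) ->
  ((e.+1 < p)%N -> cop (k + 2) (k + e%:Z + 1)) ->
  marked_cycle k n.
Proof.
move=> e2 ep pn c0p cme c1p c2e; set b := k + n%:Z - 1.
exists (rev (run (k + 2) e.-1) ++ run (k + e%:Z + 1) (p - e.+1)), (k + 1), k,
  (run (k + p%:Z) (n.-1 - p)).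
split; last by right.
  apply: ham_cycleI.
  - rewrite (_ : e.-1 = (e - 2).+1); last lia.
    rewrite (_ : (n.-1 - p)%N = (n.-2 - p).+1); last lia.
    rewrite runSr rev_rcons runS /= (_ : k + 2 + (e - 2)%:Z = k + e%:Z); last lia.
    rewrite cme /= -cats1 -!catA {1}(_ : k + e%:Z = k + 2 + (e - 2)%:Z); last lia.
    rewrite path_run_rev.
    have ct : path cop (k + 1) (([:: k, k + p%:Z & run (k + p%:Z + 1) (n.-2 - p)]) ++ [:: b]).
      rewrite /= c0p path_run /= [cop (k + 1) k]cop_sym cop_succ /=.
      rewrite (_ : b = k + p%:Z + (n.-2 - p)%:Z + 1) ?cop_succ //; lia.
    (* For e = p-1 the stretch e+1, ..., p-1 is empty and 2 is followed directly by 1. *)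
    case: (ltnP e.+1 p) => [ep'|ep'].
      rewrite (_ : (p - e.+1)%N = (p - e.+2).+1); last lia.
      rewrite runS cat_cons [path _ _ _]/= path_run c2e //=.
      rewrite (_ : k + e%:Z + 1 + (p - e.+2)%:Z = k + p%:Z - 1); last lia.
      by rewrite cop_sym c1p.
    rewrite (_ : (p - e.+1)%N = 0%N); last lia.
    by move: ct; rewrite /= (_ : cop (k + 2) (k + 1)) // (_ : k + 1 = k + 2 - 1) ?cop_pred //; lia.
  - by rewrite /= !size_cat size_rev /= !size_run; lia.
  - by move=> z hz; rewrite inE !mem_cat mem_rev !mem_run !inE mem_run; lia.
rewrite (_ : (n.-1 - p)%N = (n.-2 - p).+1); last lia.
by rewrite runS /= last_run; lia.
Qed.

(** * Odd primes not dividing an end vertex *)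

Definition has_small_nondivisor (n : nat) (x : int) : Prop :=
  exists p : nat, [/\ prime p, odd p, (p < n)%N & ~~ (p%:Z %| x)%Z].

Lemma small_nondivisorP (n : nat) (x : int) :
  has_small_nondivisor n x \/
  (forall r : nat, prime r -> odd r -> (r < n)%N -> (r%:Z %| x)%Z).
Proof.
case: (boolP (has (fun p : nat => [&& prime p, odd p & ~~ (p%:Z %| x)%Z]) (iota 0 n))).
  by case/hasP=> p; rewrite mem_iota => pn /and3P[pp op np]; left; exists p.
move/hasPn=> h; right=> r pr or_ rn; move: (h r).
by rewrite mem_iota rn pr or_ /= negbK => ->.
Qed.

Lemma min_nondivisor (n : nat) (x : int) : has_small_nondivisor n x ->
  exists p : nat, [/\ prime p, odd p, (p < n)%N, ~~ (p%:Z %| x)%Z &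
    forall r : nat, prime r -> odd r -> (r < p)%N -> (r%:Z %| x)%Z].
Proof.
case=> p [pp op pn np].
have ex : exists p : nat, [&& prime p, odd p & ~~ (p%:Z %| x)%Z] by exists p; apply/and3P.
case: (ex_minnP ex) => m /and3P[pm om nm] min; exists m; split=> //.
  by apply: leq_ltn_trans pn; apply: min; apply/and3P.
by move=> r pr or_; apply: contraTT => nr; rewrite -leqNgt; apply: min; apply/and3P.
Qed.

Lemma small_nondivisor_opp (n : nat) (x : int) :
  has_small_nondivisor n x -> has_small_nondivisor n (- x).
Proof. by case=> p [pp op pn np]; exists p; split; rewrite ?rpredN. Qed.

Lemma odd_prime_divisor (N : nat) : odd N -> (1 < N)%N ->
  exists r, [/\ prime r, odd r, (r <= N)%N & (r %| N)%N].
Proof.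
move=> oN N1; exists (pdiv N); split.
- exact: pdiv_prime.
- exact: dvdn_odd (pdiv_dvd N) oN.
- by apply: dvdn_leq (pdiv_dvd N); lia.
- exact: pdiv_dvd.
Qed.

Lemma dvdz_diff_nat (r : nat) (x y : int) (d : nat) :
  (r%:Z %| x)%Z -> (r%:Z %| y)%Z -> y = x + d%:Z -> (r %| d)%N.
Proof.
move=> rx ry e; have := dvdz_subr _ _ _ rx ry.
by rewrite e addrC addKr dvdzE !absz_nat.
Qed.

Lemma odd_prime_gt2 (r : nat) : prime r -> odd r -> (2 < r)%N.
Proof. by case: r => [|[|[|r]]]. Qed.

Lemma odd_prime_ndvd (r d : nat) : prime r -> odd r -> (0 < d < 3)%N -> ~~ (r %| d)%N.
Proof.
move=> pr or_ hd; apply/negP => /dvdn_leq; have := odd_prime_gt2 _ pr or_; lia_nodvd.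
Qed.

Lemma odd_dvdn_add2 (r N : nat) :
  odd N -> prime r -> (r %| N)%N -> (r %| N + 2)%N -> False.
Proof.
move=> oN pr rN; rewrite dvdn_addr // => r2.
by apply/negP: r2; apply: odd_prime_ndvd => //; apply: dvdn_odd rN oN.
Qed.

(** * Even order, by induction *)

Definition has_marked_cycles (n : nat) : Prop :=
  ~~ odd n -> (3 < n)%N ->
  forall k : int, has_small_nondivisor n k ->
  has_small_nondivisor n (k + n%:Z - 1) -> marked_cycle k n.

(** Since p+q < n-1, the prime p still serves for the lower end of the shortened interval; only the
    new upper end b-q+1 needs a hypothesis. *)
Lemma marked_cycle_step (n : nat) (k : int) (p q : nat) :
  (forall n', (n' < n)%N -> has_marked_cycles n') -> ~~ odd n ->
  prime p -> odd p -> ~~ (p%:Z %| k)%Z ->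
  prime q -> odd q -> ~~ (q%:Z %| k + n%:Z - 1)%Z -> (p + q < n.-1)%N ->
  has_small_nondivisor (n - q).+1 (k + n%:Z - q%:Z) -> marked_cycle k n.
Proof.
move=> IH on pp op np pq oq nq lt hs.
have p2 := odd_prime_gt2 _ pp op; have q2 := odd_prime_gt2 _ pq oq.
apply: (marked_cycle_extend k n q) => //; first lia_nodvd.
  exact: cop_subr_prime.
apply: IH; try lia_nodvd.
  by exists p; split=> //; lia_nodvd.
by rewrite (_ : k + _ - 1 = k + n%:Z - q%:Z) //; lia_nodvd.
Qed.

Lemma marked_cycle_ordered (n : nat) (k : int) (p q : nat) :
  (forall n', (n' < n)%N -> has_marked_cycles n') -> ~~ odd n -> (3 < n)%N ->
  prime p -> odd p -> (p < n)%N -> ~~ (p%:Z %| k)%Z ->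
  (forall r : nat, prime r -> odd r -> (r < p)%N -> (r%:Z %| k)%Z) ->
  prime q -> odd q -> ~~ (q%:Z %| k + n%:Z - 1)%Z ->
  (forall r : nat, prime r -> odd r -> (r < q)%N -> (r%:Z %| k + n%:Z - 1)%Z) ->
  (q <= p)%N -> marked_cycle k n.
Proof.
move=> IH on n4 pp op pn np minp pq oq nq minq qp.
have p2 := odd_prime_gt2 _ pp op; have q2 := odd_prime_gt2 _ pq oq.
have [pn1|pn1] := eqVneq p n.-1.
  apply: marked_cycle_closed => //.
  by rewrite (_ : k + n%:Z - 1 = k + p%:Z) ?cop_addr_prime //; lia_nodvd.
have {}pn : (p.+1 < n)%N by lia_nodvd.
(* A prime factor of p-2 is below p, so it divides k and hence not k+1. *)
have c1p : cop (k + 1) (k + p%:Z - 1).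
  rewrite (_ : k + p%:Z - 1 = k + 1 + (p - 2)%:Z); last lia_nodvd.
  apply: cop_addr_odd => [|r pr or_ rp]; first lia_nodvd.
  have rlt : (r < p)%N by have := dvdn_leq _ rp; lia_nodvd.
  apply/negP => r1; have := dvdz_diff_nat _ _ _ 1 (minp _ pr or_ rlt) r1 erefl.
  by apply/negP/odd_prime_ndvd.
have c2e e : ~~ odd e -> (1 < e)%N -> (e.+1 < p)%N -> cop (k + 2) (k + e%:Z + 1).
  move=> oe e1 ep.
  rewrite (_ : k + e%:Z + 1 = k + 2 + (e - 1)%:Z); last lia_nodvd.
  apply: cop_addr_odd => [|r pr or_ re]; first lia_nodvd.
  have rlt : (r < p)%N by have := dvdn_leq _ re; lia_nodvd.
  apply/negP => r1; have := dvdz_diff_nat _ _ _ 2 (minp _ pr or_ rlt) r1 erefl.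
  by apply/negP/odd_prime_ndvd.
case: (ltnP (p + q) n.-1) => [lt|ge]; last first.
  (* Here e = n-1-q is the position of b-q relative to k. It is even and p is odd, so e <= p is
     strict; likewise e >= 2, as q <= p < n-1. *)
  apply: (marked_cycle_chords k n p (n.-1 - q)) => //; try lia_nodvd.
  - exact: cop_addr_prime.
  - rewrite (_ : k + (n.-1 - q)%:Z = k + n%:Z - 1 - q%:Z) ?cop_subr_prime //; lia_nodvd.
  - by apply: c2e; lia_nodvd.
case: (small_nondivisorP (n - q).+1 (k + n%:Z - q%:Z)) => [|alldiv].
  exact: marked_cycle_step IH on pp op np pq oq nq lt.
have [q3|q3] := eqVneq q 3%N; last first.
  (* A prime factor of q-2 divides b by [minq] and b-q+1 by [alldiv], hence their difference q-1 =
     (q-2)+1, which is absurd. *)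
  have [||r [pr or_ rq rd]] := odd_prime_divisor (q - 2)%N; try lia_nodvd.
  have r1 := alldiv _ pr or_ ltac:(lia_nodvd).
  have r2 := minq _ pr or_ ltac:(lia_nodvd).
  have := dvdz_diff_nat _ _ _ (q - 1)%N r1 r2 ltac:(lia_nodvd).
  rewrite (_ : (q - 1)%N = (q - 2 + 1)%N); last lia_nodvd.
  by rewrite dvdn_addr // => h; have := odd_prime_ndvd _ 1 pr or_ isT; rewrite h.
subst q.
have [p3|p3] := eqVneq p 3%N; last first.
  (* The edge from b to k+2 spans n-3. An odd prime dividing n-3 and k+2 would divide k+n-3 by
     [alldiv], hence n-5, hence 2. *)
  apply: (marked_cycle_chords k n p 2) => //.
  - exact: cop_addr_prime.
  - rewrite cop_sym (_ : k + n%:Z - 1 = k + 2%:Z + (n - 3)%:Z); last lia_nodvd.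
    apply: cop_addr_odd => [|r pr or_ rn]; first lia_nodvd.
    apply/negP => r1.
    have rlt : (r < (n - 3).+1)%N by have := dvdn_leq _ rn; lia_nodvd.
    have r2 := alldiv _ pr or_ rlt.
    have := dvdz_diff_nat _ _ _ (n - 5)%N r1 r2 ltac:(lia_nodvd) => r3.
    apply: (odd_dvdn_add2 r (n - 5)) => //; first lia_nodvd.
    by rewrite (_ : (n - 5 + 2)%N = (n - 3)%N) //; lia_nodvd.
  - by apply: c2e.
subst p.
pose k' := 1 - k - n%:Z.
have ek : k = 1 - k' - n%:Z by rewrite /k'; lia_nodvd.
rewrite ek; apply: marked_cycle_opp => //.
apply: (marked_cycle_step n _ 3 3) => //.
- by rewrite (_ : k' = - (k + n%:Z - 1)) ?rpredN // /k'; lia_nodvd.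
- by rewrite (_ : k' + _ - 1 = - k) ?rpredN // /k'; lia_nodvd.
(* If the mirrored reduction failed too, a prime factor of n-3 would divide both k+n-3 and k+2,
   hence n-5, hence 2. *)
case: (small_nondivisorP (n - 3).+1 (k' + n%:Z - 3%:Z)) => // alldiv'.
have [||r [pr or_ rq rd]] := odd_prime_divisor (n - 3)%N; try lia_nodvd.
have r1 := alldiv _ pr or_ ltac:(lia_nodvd).
have r2 := alldiv' _ pr or_ ltac:(lia_nodvd).
rewrite -rpredN in r2.
have := dvdz_diff_nat _ _ _ (n - 5)%N r2 r1 ltac:(rewrite /k'; lia_nodvd) => r3.
exfalso; apply: (odd_dvdn_add2 r (n - 5)) => //; first lia_nodvd.
by rewrite (_ : (n - 5 + 2)%N = (n - 3)%N) //; lia_nodvd.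
Qed.

Lemma marked_cycle_even (n : nat) : has_marked_cycles n.
Proof.
elim/ltn_ind: n => n IH on n4 k.
move=> /min_nondivisor[p [pp op pn np minp]] /min_nondivisor[q [pq oq qn nq minq]].
case: (leqP q p) => [qp|pq'].
  exact: (marked_cycle_ordered n k p q).
pose k' := 1 - k - n%:Z.
have ek : k = 1 - k' - n%:Z by rewrite /k'; lia_nodvd.
have e1 : k' = - (k + n%:Z - 1) by rewrite /k'; lia_nodvd.
have e2 : k' + n%:Z - 1 = - k by rewrite /k'; lia_nodvd.
rewrite ek; apply: marked_cycle_opp => //.
apply: (marked_cycle_ordered n k' q p) => //; rewrite ?e2 ?e1 ?rpredN //; try lia_nodvd.
- by move=> r pr or_ rq; rewrite rpredN minq.
- by move=> r pr or_ rq; rewrite rpredN minp.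
Qed.

(** * Odd order *)

Lemma cop_add2 (x : int) : ~~ (2 %| x)%Z -> cop x (x + 2).
Proof.
move=> nx; apply: (cop_addr x 2) => // r pr.
by rewrite dvdn_prime2 // => /eqP->.
Qed.

(** The new vertex k+n goes into the marked edge between k+n-1 and k+n-2; being odd, it is coprime
    to the latter. *)
Lemma marked_cycle_insert_last (k : int) (n : nat) : ~~ (2 %| k + n%:Z)%Z ->
  (0 < n)%N -> marked_cycle k n -> exists c, ham_cycle k n.+1 c.
Proof.
move=> ob n0 [s [x [y [t [/andP[cc pc] ht _]]]]].
exists (k + n%:Z :: k + n%:Z - 1 :: s ++ x :: y :: t).
move eu: (s ++ _) cc pc => u cc pc.
have lu : last (k + n%:Z - 1) u = k + n%:Z - 2 by rewrite -eu last_cat.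
apply: ham_cycleI.
- move: cc; rewrite /= !rcons_path lu cop_pred => /andP[-> _] /=.
  rewrite {2}(_ : k + n%:Z = k + n%:Z - 2 + 2) ?cop_add2; lia.
- by move: (perm_size pc); rewrite size_run /=; lia.
- by move=> z hz; move: (perm_mem pc z); rewrite mem_run !inE; case: (z \in u); lia.
Qed.

Lemma ham_cycle_odd (k : int) (n : nat) : odd n -> (2 < n)%N -> ~~ (2 %| k)%Z ->
  exists c, ham_cycle k n c.
Proof.
move=> on n3 ok; have [n_3|n_3] := eqVneq n 3%N.
  exists [:: k; k + 1; k + 1 + 1]; rewrite n_3; apply: ham_cycleI => //.
    by rewrite /= !cop_succ cop_sym (_ : k + 1 + 1 = k + 2) ?cop_add2 //; lia.
  by move=> z hz; rewrite !inE; lia.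
have em : ~~ odd n.-1 by lia.
have m4 : (3 < n.-1)%N by lia.
have en : n = n.-1.+1 by lia.
have insert k' : ~~ (2 %| k')%Z -> has_small_nondivisor n.-1 k' ->
    has_small_nondivisor n.-1 (k' + n.-1%:Z - 1) -> exists c, ham_cycle k' n c.
  move=> ok' h1 h2; rewrite en; apply: marked_cycle_insert_last; try lia.
  exact: marked_cycle_even.
(* The ends left after deleting the last vertex, k and k+n-2, differ by n-2. If r divides one of
   them it divides both, hence neither k+1 nor k+n-1, and the first vertex can be deleted
   instead. *)
have [||r [pr or_ rm rd]] := odd_prime_divisor (n.-1 - 1)%N; try lia.
have r1 : ~~ (r %| 1)%N by exact: odd_prime_ndvd.
have rlt : (r < n.-1)%N by lia.
have mirror : has_small_nondivisor n.-1 (k + n%:Z - 1) ->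
    has_small_nondivisor n.-1 (k + 1) -> exists c, ham_cycle k n c.
  move=> /small_nondivisor_opp h1 /small_nondivisor_opp h2.
  have [|||c /ham_cycle_opp hc] := insert (1 - k - n%:Z); first lia.
  - by rewrite (_ : 1 - k - n%:Z = - (k + n%:Z - 1)) //; lia.
  - by rewrite (_ : 1 - k - n%:Z + n.-1%:Z - 1 = - (k + 1)) //; lia.
  by exists (map -%R c); move: hc; rewrite (_ : 1 - _ - _ = k) //; lia.
have e1 : k + n%:Z - 1 = k + (n.-1)%:Z by lia.
have e2 : k + (n.-1)%:Z - 1 = k + (n.-1 - 1)%:Z by lia.
have e3 : k + (n.-1)%:Z = k + (n.-1)%:Z - 1 + 1%:Z by lia.
have e4 : k + (n.-1)%:Z - 1 = k + 1 + (n.-1 - 2)%:Z by lia.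
case: (small_nondivisorP n.-1 k) => [hk|/(_ r pr or_ rlt) rk];
  [case: (small_nondivisorP n.-1 (k + n.-1%:Z - 1)) =>
     [hb|/(_ r pr or_ rlt) rb]; first exact: insert |];
  apply: mirror.
- case: (small_nondivisorP n.-1 (k + n%:Z - 1)) => [//|/(_ r pr or_ rlt)].
  by rewrite e1 => rb'; rewrite (dvdz_diff_nat _ _ _ 1 rb rb') in r1.
- case: (small_nondivisorP n.-1 (k + 1)) => [//|/(_ r pr or_ rlt) rb'].
  have := dvdz_diff_nat _ _ _ _ rb' rb e4.
  move: rd; rewrite (_ : (n.-1 - 1)%N = (n.-1 - 2 + 1)%N); last lia_nodvd.
  by move=> + h; rewrite dvdn_addr // (negPf r1).
- case: (small_nondivisorP n.-1 (k + n%:Z - 1)) => [//|/(_ r pr or_ rlt)].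
  rewrite e1 => rb'; have := dvdz_diff_nat _ _ _ _ rk rb' erefl.
  rewrite (_ : n.-1 = n.-1 - 1 + 1)%N; last lia_nodvd.
  by rewrite dvdn_addr // (negPf r1).
- case: (small_nondivisorP n.-1 (k + 1)) => [//|/(_ r pr or_ rlt) rb'].
  by rewrite (dvdz_diff_nat _ _ _ 1 rk rb') in r1.
Qed.

(** * Necessity: parity counting and neighbours of the end vertices *)

(** If the two coincided, two applications of [next] would return to [x], closing the cycle after
    two vertices. *)
Lemma next_neq_prev (T : eqType) (c : seq T) (x : T) :
  uniq c -> x \in c -> (2 < size c)%N -> next c x != prev c x.
Proof.
move=> uc xc sc; have [i s ec] := rot_to xc.
have uc' : uniq (rot i c) by rewrite rot_uniq.
rewrite -(next_rot i uc) -(prev_rot i uc).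
apply/eqP => e; have := next_prev uc' x; rewrite -e.
move: uc' sc; rewrite -(size_rot i) ec; case: s {ec e} => [|y [|z s]] //=.
rewrite eqxx !inE negb_or => /andP[/andP[nxy /norP[nxz _]] _] _.
by rewrite eq_sym (negPf nxy) eqxx => /eqP; rewrite eq_sym (negPf nxz).
Qed.

Lemma perm_map_next (T : eqType) (c : seq T) : uniq c -> perm_eq (map (next c) c) c.
Proof.
move=> uc; apply: uniq_perm => //.
  by rewrite map_inj_uniq //; exact: can_inj (prev_next uc).
move=> y; apply/mapP/idP => [[x xc ->]|yc]; first by rewrite mem_next.
by exists (prev c y); rewrite ?mem_prev ?next_prev.
Qed.

(** Since [next] permutes [c], the set [E] and its preimage under [next] have equal counts, and
    independence makes them disjoint. When the bound is attained they cover [c], so membership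
    alternates. *)
Lemma cycle_independent (T : eqType) (e : rel T) (E : pred T) (c : seq T) :
  uniq c -> cycle e c -> (forall x y, e x y -> ~~ (E x && E y)) ->
  (2 * count E c <= size c)%N /\
  ((2 * count E c)%N = size c -> forall x, x \in c -> E (next c x) = ~~ E x).
Proof.
move=> uc cc ind.
have cnt : count (preim (next c) E) c = count E c.
  by rewrite -count_map; apply/permP/perm_map_next.
have c0 : count (predI E (preim (next c) E)) c = 0%N.
  apply/eqP; rewrite -leqn0 leqNgt -has_count; apply/hasPn => x xc /=.
  exact: ind (next_cycle cc xc).
have := count_predUI E (preim (next c) E) c.
rewrite c0 addn0 cnt addnn -mul2n => cU; rewrite -cU; split; first exact: count_size.
move/eqP; rewrite -all_count => /allP h x xc.
by move: (h x xc) (ind _ _ (next_cycle cc xc)) => /=; case: (E x); case: (E _).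
Qed.

Lemma cop_ndvd (x y : int) (r : nat) : cop x y -> (1 < r)%N ->
  (r%:Z %| x)%Z -> (r%:Z %| y)%Z -> False.
Proof.
case/andP=> _ /eqP g1 r1 rx ry.
have : (r%:Z %| gcdz x y)%Z by rewrite dvdz_gcd rx.
by rewrite g1 dvdzE !absz_nat dvdn1; lia.
Qed.

Lemma count_even_run (k : int) (n : nat) :
  count (fun x : int => (2 %| x)%Z) (run k n) = if (2 %| k)%Z then uphalf n else n./2.
Proof.
elim: n k => [|n IH] k; first by case: ifP.
by rewrite runS [count _ _]/= IH; case: ifP; case: ifP; lia.
Qed.

(** An odd distance above 1 has an odd prime factor below n; it divides v, hence also w. *)
Lemma near_neighbour (v w : int) (n : nat) :
  (forall r : nat, prime r -> odd r -> (r < n)%N -> (r%:Z %| v)%Z) ->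
  cop v w -> (2 %| w)%Z = ~~ (2 %| v)%Z -> v - n%:Z < w < v + n%:Z ->
  w = v + 1 \/ w = v - 1.
Proof.
move=> hr cvw par rng.
have od : odd `|w - v|%N by clear hr cvw; lia.
have [d1|d1] := ltnP 1 `|w - v|%N; last by clear hr cvw par; lia.
have [r [pr or_ rle rd]] := odd_prime_divisor _ od d1.
have rv : (r%:Z %| v)%Z by apply: hr => //; clear -rle rng; lia.
have rw : (r%:Z %| w)%Z.
  by rewrite -(subrK v w) rpredD // dvdzE absz_nat.
by case: (cop_ndvd _ _ _ cvw (prime_gt1 pr) rv rw).
Qed.

(** Even vertices are independent. For even n they are exactly half of all vertices, which is the
    extremal case and forces alternation. *)
Lemma ham_cycle_parity (k : int) (n : nat) c : ham_cycle k n c ->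
  (2 * (if (2 %| k)%Z then uphalf n else n./2) <= n)%N /\
  (~~ odd n -> forall x, x \in c -> (2 %| next c x)%Z = ~~ (2 %| x)%Z).
Proof.
case/andP=> cc pc.
have uc : uniq c by rewrite (perm_uniq pc) run_uniq.
have ind (x y : int) : cop x y -> ~~ ((2 %| x)%Z && (2 %| y)%Z).
  by move=> cxy; apply/andP => -[]; apply: (cop_ndvd x y 2).
have [] := cycle_independent _ _ (fun x : int => (2 %| x)%Z) _ uc cc ind.
rewrite (permP pc) count_even_run (perm_size pc) size_run => h1 h2.
split=> // on; apply: h2; move: h1; case: ifP; lia.
Qed.

Lemma ham_cycle_nondivisor (k : int) (n : nat) c v : (2 < n)%N -> ~~ odd n ->
  ham_cycle k n c -> v = k \/ v = k + n%:Z - 1 -> has_small_nondivisor n v.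
Proof.
move=> n3 on hc hv; case: (small_nondivisorP n v) => // hr.
have [_ /(_ on) par] := ham_cycle_parity _ _ _ hc.
case/andP: hc => cc pc.
have uc : uniq c by rewrite (perm_uniq pc) run_uniq.
have sc : size c = n by rewrite (perm_size pc) size_run.
have mc x : (x \in c) = (k <= x < k + n%:Z) by rewrite (perm_mem pc) mem_run.
have vc : v \in c by rewrite mc; clear hr; lia.
(* Only one of v+1 and v-1 lies in the interval, so both cycle neighbours of v would be that
   vertex. *)
have near w : w \in c -> cop v w -> (2 %| w)%Z = ~~ (2 %| v)%Z ->
    w = if v == k then k + 1 else k + n%:Z - 2.
  rewrite mc => wr cvw pw.
  have [||] := near_neighbour _ _ _ hr cvw pw; clear hr; try lia.
  - by case: eqP; lia.
  - by case: eqP; lia.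
have := next_neq_prev _ _ _ uc vc; rewrite sc n3 => /(_ isT)/eqP[].
rewrite (near (next c v)) ?mem_next ?par ?next_cycle //.
rewrite (near (prev c v)) ?mem_prev //.
  by rewrite cop_sym prev_cycle.
by have := par (prev c v); rewrite mem_prev next_prev // => /(_ vc)->; rewrite negbK.
Qed.

Theorem theorem1p3 (k : int) (n : nat) (hn : (3 <= n)%N) :
  hamiltonian (@CP k n) <->
  (odd n /\ ~~ (2 %| k)%Z) \/
  (~~ odd n /\
   (exists p : nat, [/\ prime p, odd p, (p < n)%N & ~~ (p%:Z %| k)%Z]) /\
   (exists q : nat, [/\ prime q, odd q, (q < n)%N & ~~ (q%:Z %| k + n%:Z - 1)%Z])).
Proof.
split=> [/hamiltonian_ham_cycle[c hc]|].
  case: (boolP (odd n)) => on; [left|right]; split=> //.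
    by have [] := ham_cycle_parity _ _ _ hc; case: ifP => //; lia.
  by split; apply: (ham_cycle_nondivisor k n c) => //; [left|right].
have conclude : (exists c, ham_cycle k n c) -> hamiltonian (@CP k n).
  by case=> c; exact: ham_cycle_hamiltonian.
case=> [[on ok]|[on [hp hq]]]; apply: conclude.
  exact: ham_cycle_odd.
apply: marked_cycle_ham; apply: marked_cycle_even => //; lia.
Qed.
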